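(* If $f\in\mathrm{elh}(\mathbb{C})$ has a Picard exceptional value, i.e. $f(\mathbb{C})=\mathbb{C}\setminus\{a\}$ for some $a\in\mathbb{C}$, then $f$ is not prime.
   Context: $\mathrm{elh}(\mathbb{C})$ is the set of all entire functions $f:\mathbb{C}\to\mathbb{C}$ with $f'(z)\neq 0$ for all $z\in\mathbb{C}$ and $f'(0)=1$. $\mathrm{Aut}(\mathbb{C})=\{z+a : a\in\mathbb{C}\}\subseteq\mathrm{elh}(\mathbb{C})$. A function $c\in\mathrm{elh}(\mathbb{C})$ is composite if there are entire functions $f,g$, neither of which is an affine map $z\mapsto \alpha z+\beta$ ($\alpha\in\mathbb{C}^\times$, $\beta\in\mathbb{C}$), such that $c=f\circ g$. The factors $f,g$ are not required to lie in $\mathrm{elh}(\mathbb{C})$. A function $p\in\mathrm{elh}(\mathbb{C})\setminus\mathrm{Aut}(\mathbb{C})$ is prime if it is not composite. *)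

(* Defs.v *)
From Stdlib Require Import Reals.
From Coquelicot Require Import Coquelicot.

Open Scope C_scope.

(* On functions [C -> C], [ex_derive] is resolved over [C_AbsRing], so this is
   complex (not real) differentiability at every point. *)
Definition entire (f : C -> C) : Prop := forall z : C, ex_derive f z.

Definition elh (f : C -> C) : Prop :=
  entire f /\ (forall z : C, C_derive f z <> 0) /\ C_derive f 0 = 1.

Definition AutC (f : C -> C) : Prop :=
  exists a : C, forall z : C, f z = z + a.

(* Constants are not affine in this sense; a composite with a constant factor
   is itself constant, hence never in [elh]. *)
Definition affine (f : C -> C) : Prop :=
  exists alpha beta : C, alpha <> 0 /\ forall z : C, f z = alpha * z + beta.

Definition composite (c : C -> C) : Prop :=
  elh c /\
  exists f g : C -> C,
    entire f /\ entire g /\ ~ affine f /\ ~ affine g /\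
    forall z : C, c z = f (g z).

Definition prime_elh (p : C -> C) : Prop :=
  elh p /\ ~ AutC p /\ ~ composite p.

(* Main.v *)
(** If [f] omits [a], then [F = f - a] has an entire square root up to a
    constant, [F = F(0) g^2], and so [f] is [w |-> F(0) w^2 + a] after [g].  The
    first factor is not affine, and neither is [g], since it has no zero.  This
    treats [exp o affine] at the same time as the other functions [a + exp o h].

    On a disc the square root is the telescoping product of the principal roots
    of [F(kz/N) / F((k-1)z/N)], with [N] so large that every quotient lies in
    the right half-plane.  Roots that agree at [0] agree everywhere, so these
    glue, and a continuous square root of a nonvanishing differentiable function
    is differentiable.  Only continuity of [F] is needed to construct it, so no
    integration theory enters. *)

Require Import Defs.
From Stdlib Require Import Reals Lra Lia ClassicalEpsilon.
From Coquelicot Require Import Coquelicot.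

Open Scope C_scope.

(** * Continuity and differentiability on the plane in terms of [Cmod] *)

Definition Ccontinuous (f : C -> C) (z : C) : Prop :=
  forall eps : R, (0 < eps)%R ->
  exists delta : R, (0 < delta)%R /\
    forall w : C, (Cmod (w - z) < delta)%R -> (Cmod (f w - f z) < eps)%R.

Lemma Ccontinuous_const (c z : C) : Ccontinuous (fun _ => c) z.
Proof.
  intros eps Heps; exists 1%R; split; [lra|]; intros w _.
  replace (c - c) with (RtoC 0) by ring; rewrite Cmod_0; lra.
Qed.

Lemma Ccontinuous_scal (c z : C) : Ccontinuous (fun w => c * w) z.
Proof.
  intros eps Heps; pose proof (Cmod_ge_0 c) as Hc.
  exists (eps / (Cmod c + 1))%R; split; [apply Rdiv_lt_0_compat; lra|].
  intros w Hw; replace (c * w - c * z) with (c * (w - z)) by ring.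
  rewrite Cmod_mult.
  apply Rle_lt_trans with (Cmod c * (eps / (Cmod c + 1)))%R.
  - apply Rmult_le_compat_l; lra.
  - apply Rlt_le_trans with ((Cmod c + 1) * (eps / (Cmod c + 1)))%R.
    + apply Rmult_lt_compat_r; [apply Rdiv_lt_0_compat; lra|lra].
    + right; field; lra.
Qed.

Lemma Ccontinuous_comp (f g : C -> C) (z : C) :
  Ccontinuous g z -> Ccontinuous f (g z) -> Ccontinuous (fun w => f (g w)) z.
Proof.
  intros Hg Hf eps Heps.
  destruct (Hf eps Heps) as [d [Hd Hf']].
  destruct (Hg d Hd) as [d' [Hd' Hg']].
  exists d'; split; auto.
Qed.

Lemma Ccontinuous_mult (f g : C -> C) (z : C) :
  Ccontinuous f z -> Ccontinuous g z -> Ccontinuous (fun w => f w * g w) z.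
Proof.
  intros Hf Hg eps Heps.
  pose proof (Cmod_ge_0 (f z)) as Hfz; pose proof (Cmod_ge_0 (g z)) as Hgz.
  set (M := (Cmod (f z) + Cmod (g z) + 1)%R).
  assert (HM : (0 < M)%R) by (unfold M; lra).
  assert (He : (0 < eps / M)%R) by (apply Rdiv_lt_0_compat; lra).
  (* With both increments below [e] and [e] at most 1, the three terms of the expansion below add up
     to less than [e * M]. *)
  set (e := Rmin 1 (eps / M)).
  assert (He1 : (0 < e)%R) by (apply Rmin_glb_lt; lra).
  assert (He2 : (e <= 1)%R) by apply Rmin_l.
  assert (He3 : (e <= eps / M)%R) by apply Rmin_r.
  destruct (Hf e He1) as [d1 [Hd1 H1]].
  destruct (Hg e He1) as [d2 [Hd2 H2]].
  exists (Rmin d1 d2); split; [now apply Rmin_glb_lt|]; intros w Hw.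
  specialize (H1 w (Rlt_le_trans _ _ _ Hw (Rmin_l _ _))).
  specialize (H2 w (Rlt_le_trans _ _ _ Hw (Rmin_r _ _))).
  replace (f w * g w - f z * g z) with
    ((f w - f z) * (g w - g z) + (f w - f z) * g z + f z * (g w - g z)) by ring.
  pose proof (Cmod_ge_0 (f w - f z)) as P1; pose proof (Cmod_ge_0 (g w - g z)) as P2.
  eapply Rle_lt_trans; [apply Cmod_triangle|].
  eapply Rle_lt_trans; [apply Rplus_le_compat_r, Cmod_triangle|].
  rewrite !Cmod_mult.
  assert (HeM : (e * M <= eps)%R).
  { apply Rle_trans with (eps / M * M)%R; [apply Rmult_le_compat_r; lra|].
    right; field; lra. }
  unfold M in HeM.
  assert (Cmod (f w - f z) * Cmod (g w - g z) < e * 1)%R by nra.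
  nra.
Qed.

Lemma Ccontinuous_inv (z : C) : z <> 0 -> Ccontinuous Cinv z.
Proof.
  intros Hz eps Heps; assert (H := proj1 (Cmod_gt_0 z) Hz).
  (* The first bound keeps [Cmod w] above [Cmod z / 2]; the second then controls
     [(w - z) / (w * z)]. *)
  exists (Rmin (Cmod z / 2) (eps * (Cmod z * Cmod z) / 2)); split.
  { apply Rmin_glb_lt; [lra|].
    assert (0 < Cmod z * Cmod z)%R by nra.
    assert (0 < eps * (Cmod z * Cmod z))%R by nra. lra. }
  intros w Hw.
  assert (Hw1 := Rlt_le_trans _ _ _ Hw (Rmin_l _ _)).
  assert (Hw2 := Rlt_le_trans _ _ _ Hw (Rmin_r _ _)).
  assert (Hwz : (Cmod z / 2 < Cmod w)%R).
  { pose proof (Cmod_triangle w (- (w - z))) as T.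
    replace (w + - (w - z)) with z in T by ring. rewrite Cmod_opp in T. lra. }
  assert (Hw0 : w <> 0) by (apply Cmod_gt_0; lra).
  replace (/ w - / z) with (- (w - z) / (w * z)) by (field; auto).
  rewrite Cmod_div by (now apply Cmult_neq_0).
  rewrite Cmod_opp, Cmod_mult.
  apply Rmult_lt_reg_r with (Cmod w * Cmod z)%R; [nra|].
  unfold Rdiv; rewrite Rmult_assoc, Rinv_l, Rmult_1_r by nra.
  apply Rlt_le_trans with (1 := Hw2).
  replace (eps * (Cmod z * Cmod z) / 2)%R with (eps * (Cmod z / 2 * Cmod z))%R by field.
  apply Rmult_le_compat_l; [lra|]. apply Rmult_le_compat_r; lra.
Qed.

Lemma Ccontinuous_ext_near (f g : C -> C) (z : C) (r : R) :
  (0 < r)%R -> (forall w, (Cmod (w - z) < r)%R -> f w = g w) ->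
  Ccontinuous f z -> Ccontinuous g z.
Proof.
  intros Hr Hfg Hf eps Heps.
  destruct (Hf eps Heps) as [d [Hd H]].
  exists (Rmin r d); split; [now apply Rmin_glb_lt|]; intros w Hw.
  rewrite <- !Hfg.
  - apply H, (Rlt_le_trans _ _ _ Hw), Rmin_r.
  - replace (z - z) with (RtoC 0) by ring. now rewrite Cmod_0.
  - apply (Rlt_le_trans _ _ _ Hw), Rmin_l.
Qed.

(** Over [C_AbsRing] both the balls and the norm come from [Cmod], so unfolding the filters leaves
    exactly this estimate. *)
Lemma is_C_derive_eps (f : C -> C) (z l : C) :
  is_derive f z l <->
  forall eps : R, (0 < eps)%R -> exists delta : R, (0 < delta)%R /\
    forall w : C, (Cmod (w - z) < delta)%R ->
      (Cmod (f w - f z - (w - z) * l) <= eps * Cmod (w - z))%R.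
Proof.
  split.
  - intros [_ H] eps Heps.
    destruct (H z (fun P HP => HP) (mkposreal eps Heps)) as [d Hd].
    exists d; split; [apply cond_pos|]. intros w Hw.
    exact (Hd w Hw).
  - intros H; split; [apply is_linear_scal_l|].
    intros x Hx.
    (* The neighbourhood filter of [z] converges to [z] alone. *)
    apply (@is_filter_lim_locally_unique C_AbsRing (AbsRing_NormedModule C_AbsRing)) in Hx.
    subst x.
    intros eps. destruct (H eps (cond_pos eps)) as [d [Hd Hd']].
    exists (mkposreal d Hd). intros w Hw. exact (Hd' w Hw).
Qed.

(** * The principal square root on the right half-plane *)

(** Half-angle formulas. Where [Re w] is positive so is the radicand, and the division is
    genuine. *)
Definition Csqrt (w : C) : C :=
  (sqrt ((Cmod w + Re w) / 2), Im w / (2 * sqrt ((Cmod w + Re w) / 2)))%R.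

Lemma Re_Csqrt_gt_0 (w : C) : (0 < Re w)%R -> (0 < Re (Csqrt w))%R.
Proof.
  intros H; apply sqrt_lt_R0. pose proof (Cmod_ge_0 w). lra.
Qed.

Lemma Csqrt_sqr (w : C) : (0 < Re w)%R -> Csqrt w * Csqrt w = w.
Proof.
  intros H; pose proof (Re_Csqrt_gt_0 w H) as Hs.
  pose proof (Cmod2_alt w) as Hm. pose proof (Cmod_ge_0 w) as Hm0.
  unfold Csqrt in *; simpl in Hs |- *.
  set (s := sqrt ((Cmod w + Re w) / 2)) in *.
  assert (Hss : (s * s = (Cmod w + Re w) / 2)%R) by (apply sqrt_sqrt; lra).
  rewrite (surjective_pairing w) at 3. unfold Cmult; simpl. f_equal.
  - change (fst w) with (Re w).
    (* As [2 * (s * s)] is [Cmod w + Re w], this factors the difference of the squares of [Cmod w]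
       and [Re w]. *)
    assert (E : (Im w * Im w = (Cmod w - Re w) * (2 * (s * s)))%R)
      by (rewrite Hss; simpl in Hm; lra).
    replace (Im w / (2 * s) * (Im w / (2 * s)))%R
      with (Im w * Im w / (4 * (s * s)))%R by (field; lra).
    rewrite E, Hss. field. lra.
  - unfold Im. field. lra.
Qed.

Lemma Csqrt_1 : Csqrt 1 = 1.
Proof.
  unfold Csqrt. rewrite Cmod_1. simpl.
  replace ((1 + 1) / 2)%R with 1%R by field. rewrite sqrt_1.
  unfold RtoC; f_equal. field.
Qed.

(* From [(Csqrt w - Csqrt z) * (Csqrt w + Csqrt z) = w - z], where the second
   factor has real part at least [Re (Csqrt z)]. *)
Lemma Ccontinuous_Csqrt (z : C) : (0 < Re z)%R -> Ccontinuous Csqrt z.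
Proof.
  intros Hz eps Heps; pose proof (Re_Csqrt_gt_0 z Hz) as Hs.
  (* The first bound keeps [w] in the right half-plane, where [Csqrt_sqr] applies. *)
  exists (Rmin (Re z) (eps * Re (Csqrt z))); split.
  { apply Rmin_glb_lt; nra. }
  intros w Hw.
  assert (Hw1 := Rlt_le_trans _ _ _ Hw (Rmin_l _ _)).
  assert (Hw2 := Rlt_le_trans _ _ _ Hw (Rmin_r _ _)).
  assert (Hrw : (0 < Re w)%R).
  { pose proof (re_le_Cmod (w - z)) as Hre.
    replace (Re (w - z)) with (Re w - Re z)%R in Hre by reflexivity.
    pose proof (Rle_abs (- (Re w - Re z))) as A. rewrite Rabs_Ropp in A. lra. }
  pose proof (Re_Csqrt_gt_0 w Hrw) as Hsw.
  assert (E : (Csqrt w - Csqrt z) * (Csqrt w + Csqrt z) = w - z).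
  { transitivity (Csqrt w * Csqrt w - Csqrt z * Csqrt z); [ring|].
    now rewrite !Csqrt_sqr. }
  assert (Hp : (Re (Csqrt z) <= Cmod (Csqrt w + Csqrt z))%R).
  { apply Rle_trans with (Re (Csqrt w + Csqrt z)).
    - change (Re (Csqrt w + Csqrt z)) with (Re (Csqrt w) + Re (Csqrt z))%R. lra.
    - eapply Rle_trans; [apply Rle_abs|apply re_le_Cmod]. }
  rewrite <- E, Cmod_mult in Hw2.
  pose proof (Cmod_ge_0 (Csqrt w - Csqrt z)). nra.
Qed.

(** * Square roots on a disc *)

(* Compactness puts [z] and [w] in one of finitely many balls on which [F] differs
   from its value at the centre by less than a third of the modulus of that value. *)
Lemma Re_ratio_gt_0 (F : C -> C) (r : R) :
  (forall z, Ccontinuous F z) -> (forall z, F z <> 0) ->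
  exists delta : R, (0 < delta)%R /\
    forall z w, (Cmod z <= r)%R -> (Cmod (w - z) < delta)%R ->
      (0 < Re (F w / F z))%R.
Proof.
  intros HF Hnz.
  (* Why 3: [z] will lie in a square of half-side [d] about the centre, so at distance below
     [2 * d], and [w] within a further [d]. *)
  assert (Hloc : forall u v : R, exists d : posreal, forall w : C,
    (Cmod (w - (u, v)) < 3 * d)%R ->
    (Cmod (F w - F (u, v)) < Cmod (F (u, v)) / 3)%R).
  { intros u v. assert (H := proj1 (Cmod_gt_0 _) (Hnz (u, v))).
    destruct (HF (u, v) (Cmod (F (u, v)) / 3)%R) as [d [Hd Hd']]; [lra|].
    assert (Hd3 : (0 < d / 3)%R) by lra.
    exists (mkposreal _ Hd3). intros w Hw. apply Hd'. simpl in Hw. lra. }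
  set (delta := fun u v => proj1_sig
    (constructive_indefinite_description _ (Hloc u v))).
  assert (Hdelta : forall u v w, (Cmod (w - (u, v)) < 3 * delta u v)%R ->
    (Cmod (F w - F (u, v)) < Cmod (F (u, v)) / 3)%R).
  { intros u v. unfold delta.
    now destruct (constructive_indefinite_description _ (Hloc u v)). }
  destruct (compactness_value_2d (- r) r (- r) r delta) as [d Hd].
  exists d; split; [apply cond_pos|]. intros z w Hz Hw.
  pose proof (Rmax_Cmod z) as Hm.
  assert (H1 := Rle_trans _ _ _ (Rmax_l _ _) Hm).
  assert (H2 := Rle_trans _ _ _ (Rmax_r _ _) Hm).
  (* The compactness lemma yields a centre only under a double negation, hence the proof by
     contradiction. *)
  apply Rnot_le_lt; intros Hneg.
  apply (Hd (fst z) (snd z)).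
  - apply Rabs_le_between; lra.
  - apply Rabs_le_between; lra.
  - intros [u [v [_ [_ [Hu [Hv Hduv]]]]]].
    pose proof (cond_pos (delta u v)) as Hp.
    assert (Hzc : (Cmod (z - (u, v)) < 2 * delta u v)%R).
    { eapply Rle_lt_trans; [apply Cmod_2Rmax|].
      assert (Hmx : (Rmax (Rabs (fst (z - (u, v))%C)) (Rabs (snd (z - (u, v))%C))
              < delta u v)%R) by (apply Rmax_lub_lt; [exact Hu|exact Hv]).
      assert (S2 : (sqrt 2 <= 2)%R).
      { rewrite <- (sqrt_Rsqr 2) at 2 by lra. apply sqrt_le_1; unfold Rsqr; lra. }
      pose proof (sqrt_lt_R0 2 ltac:(lra)).
      pose proof (Rle_trans _ _ _ (Rabs_pos _)
        (Rmax_l (Rabs (fst (z - (u, v))%C)) (Rabs (snd (z - (u, v))%C)))).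
      nra. }
    assert (Hwc : (Cmod (w - (u, v)) < 3 * delta u v)%R).
    { replace (w - (u, v)) with ((w - z) + (z - (u, v))) by ring.
      eapply Rle_lt_trans; [apply Cmod_triangle|]. lra. }
    apply Hdelta in Hwc.
    assert (Hzc' : (Cmod (F z - F (u, v)) < Cmod (F (u, v)) / 3)%R)
      by (apply Hdelta; lra).
    (* [Cmod (F z)] exceeds two thirds of the modulus at the centre, while [F w - F z] stays below
       it. So the quotient lies in the unit disc about 1, inside the right half-plane. *)
    assert (Hlow : (Cmod (F (u, v)) * (2 / 3) < Cmod (F z))%R).
    { pose proof (Cmod_triangle (F z) (- (F z - F (u, v)))) as T.
      replace (F z + - (F z - F (u, v))) with (F (u, v)) in T by ring.
      rewrite Cmod_opp in T. lra. }
    assert (Hdiff : (Cmod (F w - F z) < Cmod (F z))%R).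
    { replace (F w - F z) with ((F w - F (u, v)) + - (F z - F (u, v))) by ring.
      eapply Rle_lt_trans; [apply Cmod_triangle|]. rewrite Cmod_opp. lra. }
    assert (Hq : (Cmod (F w / F z - 1) < 1)%R).
    { replace (F w / F z - 1) with ((F w - F z) / F z) by (field; apply Hnz).
      rewrite Cmod_div by apply Hnz.
      apply Rmult_lt_reg_r with (Cmod (F z)); [apply Cmod_gt_0, Hnz|].
      unfold Rdiv; rewrite Rmult_assoc, Rinv_l; [lra|].
      apply Rgt_not_eq, Cmod_gt_0, Hnz. }
    pose proof (re_le_Cmod (F w / F z - 1)) as Hre.
    change (Re (F w / F z - 1)) with (Re (F w / F z) - 1)%R in Hre.
    pose proof (Rle_abs (- (Re (F w / F z) - 1))) as A. rewrite Rabs_Ropp in A. lra.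
Qed.

(** While the quotients stay in the right half-plane, the square telescopes to [F (k h z) / F 0]. *)
Fixpoint ray_root (F : C -> C) (h : R) (k : nat) (z : C) : C :=
  match k with
  | O => 1
  | S j => ray_root F h j z *
      Csqrt (F (RtoC (INR (S j) * h) * z) / F (RtoC (INR j * h) * z))
  end.

Lemma disc_root (F : C -> C) (r : R) :
  (forall z, Ccontinuous F z) -> (forall z, F z <> 0) ->
  exists g : C -> C, g 0 = 1 /\ forall z, (Cmod z <= r)%R ->
    Ccontinuous g z /\ F z = F 0 * (g z * g z).
Proof.
  intros HF Hnz.
  destruct (Re_ratio_gt_0 F r HF Hnz) as [d [Hd Hratio]].
  (* [N * d > r] makes each step [h * z] shorter than [d]; the maximum with 1 forces [N] to be
     positive for every [r]. *)
  destruct (INR_archimed d (Rmax r 1) Hd) as [N HN].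
  assert (HN0 : (0 < INR N)%R).
  { pose proof (Rmax_r r 1). apply Rmult_lt_reg_r with d; lra. }
  set (h := (/ INR N)%R).
  assert (Hh : (0 < h)%R) by (apply Rinv_0_lt_compat; lra).
  assert (Hhr : (h * r < d)%R).
  { apply Rmult_lt_reg_l with (INR N); [lra|].
    unfold h. rewrite <- Rmult_assoc, Rinv_r, Rmult_1_l by lra.
    pose proof (Rmax_l r 1). lra. }
  assert (Hstep : forall j z, (j < N)%nat -> (Cmod z <= r)%R ->
    (0 < Re (F (RtoC (INR (S j) * h) * z)%C / F (RtoC (INR j * h) * z)%C))%R).
  { intros j z Hj Hz. pose proof (pos_INR j) as Hj0. pose proof (Cmod_ge_0 z) as Hz0.
    apply Hratio.
    - rewrite Cmod_mult, Cmod_R, Rabs_pos_eq by nra.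
      assert (INR j * h <= 1)%R.
      { apply Rmult_le_reg_r with (INR N); [lra|]. unfold h.
        rewrite Rmult_assoc, Rinv_l by lra.
        apply lt_INR in Hj. lra. }
      nra.
    - replace (RtoC (INR (S j) * h) * z - RtoC (INR j * h) * z) with (RtoC h * z)
        by (rewrite S_INR, !RtoC_mult, RtoC_plus; ring).
      rewrite Cmod_mult, Cmod_R, Rabs_pos_eq by lra. nra. }
  (* The value 1 at the origin is carried along so that roots on different discs can be compared. *)
  assert (Hk : forall k, (k <= N)%nat -> ray_root F h k 0 = 1 /\
    forall z, (Cmod z <= r)%R -> Ccontinuous (ray_root F h k) z /\
      F (RtoC (INR k * h) * z) = F 0 * (ray_root F h k z * ray_root F h k z)).
  { induction k as [|k IH]; intros Hk.
    - split; [reflexivity|]. intros z _. split; [apply Ccontinuous_const|].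
      simpl. rewrite Rmult_0_l, Cmult_0_l. ring.
    - destruct IH as [IH0 IH]; [lia|]. split.
      + cbn [ray_root]. rewrite IH0, !Cmult_0_r.
        unfold Cdiv. rewrite Cinv_r, Csqrt_1 by apply Hnz. ring.
      + intros z Hz. destruct (IH z Hz) as [IHc IHs].
        assert (Hs := Hstep k z Hk Hz). split.
        * cbn [ray_root]. apply Ccontinuous_mult; [exact IHc|].
          apply (Ccontinuous_comp Csqrt); [|now apply Ccontinuous_Csqrt].
          apply Ccontinuous_mult.
          -- apply (Ccontinuous_comp F); [apply Ccontinuous_scal|apply HF].
          -- apply (Ccontinuous_comp Cinv); [|apply Ccontinuous_inv, Hnz].
             apply (Ccontinuous_comp F); [apply Ccontinuous_scal|apply HF].
        * cbn [ray_root]. set (q := Csqrt _) in *.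
          transitivity (F 0 * (ray_root F h k z * ray_root F h k z) * (q * q));
            [|ring].
          rewrite <- IHs. unfold q. rewrite Csqrt_sqr by exact Hs.
          field. apply Hnz. }
  exists (ray_root F h N). destruct (Hk N (le_n N)) as [H0 H].
  split; [exact H0|]. intros z Hz. destruct (H z Hz) as [Hc Hs].
  split; [exact Hc|]. rewrite <- Hs. f_equal.
  unfold h. rewrite Rinv_r by lra. ring.
Qed.

(** * Uniqueness of roots and gluing *)

(* The quotient [g1 / g2] is continuous with values [1] and [-1], hence constant on
   every segment from the origin. *)
Lemma root_unique (g1 g2 : C -> C) (z : C) :
  (forall w, (Cmod w <= Cmod z)%R ->
    Ccontinuous g1 w /\ Ccontinuous g2 w /\
    g2 w <> 0 /\ g1 w * g1 w = g2 w * g2 w) ->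
  g1 0 = g2 0 -> g1 z = g2 z.
Proof.
  intros H H0.
  (* The sign makes [phi] rise from -1 at 0 to 1 at 1 when [g1 z = - g2 z], as [IVT_interv] expects.
     A zero in between is impossible, since the values are 1 and -1. *)
  set (phi := fun t : R => (- Re (g1 (RtoC t * z)%C / g2 (RtoC t * z)%C))%R).
  assert (Hin : forall t : R, (0 <= t <= 1)%R -> (Cmod (RtoC t * z)%C <= Cmod z)%R).
  { intros t Ht. rewrite Cmod_mult, Cmod_R, Rabs_pos_eq by lra.
    pose proof (Cmod_ge_0 z). nra. }
  assert (Hval : forall t : R, (0 <= t <= 1)%R ->
    g1 (RtoC t * z) = g2 (RtoC t * z) \/ g1 (RtoC t * z) = - g2 (RtoC t * z)).
  { intros t Ht. destruct (H _ (Hin t Ht)) as [_ [_ [Hg E]]].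
    destruct (Ceq_dec (g1 (RtoC t * z) - g2 (RtoC t * z)) 0) as [E1|E1].
    - left. rewrite <- (Cplus_0_r (g2 _)), <- E1. ring.
    - right. destruct (Ceq_dec (g1 (RtoC t * z) + g2 (RtoC t * z)) 0) as [E2|E2].
      + rewrite <- (Cplus_0_r (- g2 _)), <- E2. ring.
      + exfalso. apply (Cmult_neq_0 _ _ E1 E2).
        transitivity (g1 (RtoC t * z) * g1 (RtoC t * z) -
                      g2 (RtoC t * z) * g2 (RtoC t * z)); [ring|].
        rewrite E. ring. }
  assert (H1z : RtoC 1 * z = z) by ring.
  destruct (Hval 1%R) as [E|E]; [lra| | ]; rewrite H1z in E; [exact E|].
  exfalso.
  destruct (Ranalysis5.IVT_interv phi 0 1) as [t [Ht Et]].
  - intros t Ht. destruct (H _ (Hin t Ht)) as [C1 [C2 [Hg _]]].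
    assert (Hc : Ccontinuous (fun w => g1 w / g2 w) (RtoC t * z)).
    { apply Ccontinuous_mult; [exact C1|].
      apply (Ccontinuous_comp Cinv); [exact C2|now apply Ccontinuous_inv]. }
    assert (Hc' := Ccontinuous_comp (fun w => g1 w / g2 w) (fun s => z * s) (RtoC t)
             (Ccontinuous_scal z (RtoC t))).
    cbv beta in Hc'. rewrite (Cmult_comm z) in Hc'. specialize (Hc' Hc).
    intros eps Heps. destruct (Hc' eps Heps) as [d [Hd Hd']].
    exists d; split; [exact Hd|]. intros s [_ Hs].
    change (Rabs (s - t) < d)%R in Hs. change (Rabs (phi s - phi t) < eps)%R.
    specialize (Hd' (RtoC s)). rewrite <- RtoC_minus, Cmod_R in Hd'.
    specialize (Hd' Hs). eapply Rle_lt_trans; [|exact Hd'].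
    rewrite (Cmult_comm z (RtoC s)), (Cmult_comm z (RtoC t)).
    rewrite Rabs_minus_sym.
    eapply Rle_trans; [|apply re_le_Cmod]. right. f_equal.
    unfold phi.
    change (Re (?a - ?b)) with (Re a - Re b)%R. ring.
  - lra.
  - unfold phi. rewrite Cmult_0_l, H0. destruct (H 0) as [_ [_ [Hg _]]].
    { rewrite Cmod_0. apply Cmod_ge_0. }
    unfold Cdiv. rewrite Cinv_r by exact Hg. simpl. lra.
  - unfold phi. rewrite H1z, E. destruct (H z) as [_ [_ [Hg _]]]; [lra|].
    replace (- g2 z / g2 z) with (- (1)) by (field; exact Hg). simpl. lra.
  - unfold phi in Et. destruct (H _ (Hin t Ht)) as [_ [_ [Hg _]]].
    destruct (Hval t Ht) as [E'|E']; rewrite E' in Et.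
    + unfold Cdiv in Et. rewrite Cinv_r in Et by exact Hg. simpl in Et. lra.
    + replace (- g2 (RtoC t * z) / g2 (RtoC t * z)) with (- (1)) in Et
        by (field; exact Hg). simpl in Et. lra.
Qed.

Lemma continuous_root (F : C -> C) :
  (forall z, Ccontinuous F z) -> (forall z, F z <> 0) ->
  exists g : C -> C, forall z, Ccontinuous g z /\ F z = F 0 * (g z * g z).
Proof.
  intros HF Hnz.
  set (G := fun r => proj1_sig
    (constructive_indefinite_description _ (disc_root F r HF Hnz))).
  assert (HG : forall r, G r 0 = 1 /\ forall z, (Cmod z <= r)%R ->
    Ccontinuous (G r) z /\ F z = F 0 * (G r z * G r z)).
  { intros r. unfold G. now destruct (constructive_indefinite_description _ _). }
  clearbody G.
  assert (Hagree : forall r s z, (Cmod z <= r)%R -> (Cmod z <= s)%R -> G r z = G s z).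
  { intros r s z Hr Hs. destruct (HG r) as [Hr0 HGr]. destruct (HG s) as [Hs0 HGs].
    apply root_unique; [|congruence]. intros w Hw.
    destruct (HGr w) as [C1 E1]; [lra|]. destruct (HGs w) as [C2 E2]; [lra|].
    split; [exact C1|split; [exact C2|split]].
    - intros E. apply (Hnz w). rewrite E2, E. ring.
    - rewrite E1 in E2.
      transitivity (/ F 0 * (F 0 * (G r w * G r w))); [field; apply Hnz|].
      rewrite E2. field. apply Hnz. }
  (* Each point uses the disc that it bounds. Within distance 1 of [z] this agrees with the single
     root of radius [Cmod z + 1], whence continuity. *)
  exists (fun z => G (Cmod z) z). intros z. split.
  - apply (Ccontinuous_ext_near (G (Cmod z + 1)%R) _ z 1); [lra| |].
    + intros w Hw. apply Hagree; [|lra].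
      pose proof (Cmod_triangle (w - z) z) as T.
      replace (w - z + z) with w in T by ring. lra.
    + apply HG. lra.
  - apply (proj2 (HG (Cmod z))). lra.
Qed.

(** * Differentiability of the root *)

Lemma derivable_Ccontinuous (f : C -> C) (z : C) : ex_derive f z -> Ccontinuous f z.
Proof.
  intros [l Hl] eps Heps.
  destruct (proj1 (is_C_derive_eps f z l) Hl 1%R Rlt_0_1) as [d [Hd H]].
  pose proof (Cmod_ge_0 l) as Hl0.
  exists (Rmin d (eps / (Cmod l + 1))); split.
  { apply Rmin_glb_lt; [exact Hd|apply Rdiv_lt_0_compat; lra]. }
  intros w Hw.
  assert (Hw1 := Rlt_le_trans _ _ _ Hw (Rmin_l _ _)).
  assert (Hw2 := Rlt_le_trans _ _ _ Hw (Rmin_r _ _)).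
  apply Rmult_lt_compat_r with (r := (Cmod l + 1)%R) in Hw2; [|lra].
  unfold Rdiv in Hw2. rewrite Rmult_assoc, Rinv_l, Rmult_1_r in Hw2 by lra.
  replace (f w - f z) with ((f w - f z - (w - z) * l) + (w - z) * l) by ring.
  eapply Rle_lt_trans; [apply Cmod_triangle|].
  specialize (H w Hw1). rewrite Cmod_mult. lra.
Qed.

(* [2 g(z) (g(w) - g(z)) = (F(w) - F(z)) - (g(w) - g(z))^2] and
   [g(w) - g(z) = (F(w) - F(z)) / (g(w) + g(z)) = O(w - z)]. *)
Lemma derivable_root (F g : C -> C) (z : C) :
  ex_derive F z -> Ccontinuous g z -> g z <> 0 ->
  (forall w, F w = g w * g w) -> ex_derive g z.
Proof.
  intros [l Hl] Hg Hgz HFg.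
  assert (Hm := proj1 (Cmod_gt_0 _) Hgz). set (m := Cmod (g z)) in *.
  pose proof (Cmod_ge_0 l) as Hl0.
  exists (l / (2 * g z)). apply is_C_derive_eps. intros eps Heps.
  assert (Hem : (0 < eps * m)%R) by nra.
  (* [K] will bound [y / x]. Together with [y < eps * m / K] this gives [y * y <= eps * m * x]. *)
  set (K := ((Cmod l + 1) / m)%R).
  assert (HK : (0 < K)%R) by (apply Rdiv_lt_0_compat; lra).
  assert (Hq : (0 < eps * m / K)%R) by (apply Rdiv_lt_0_compat; lra).
  destruct (proj1 (is_C_derive_eps F z l) Hl (Rmin 1 (eps * m)))
    as [d1 [Hd1 H1]]; [apply Rmin_glb_lt; lra|].
  destruct (Hg (Rmin m (eps * m / K))) as [d2 [Hd2 H2]]; [now apply Rmin_glb_lt|].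
  exists (Rmin d1 d2); split; [now apply Rmin_glb_lt|]. intros w Hw.
  specialize (H1 w (Rlt_le_trans _ _ _ Hw (Rmin_l _ _))).
  specialize (H2 w (Rlt_le_trans _ _ _ Hw (Rmin_r _ _))).
  assert (H2m := Rlt_le_trans _ _ _ H2 (Rmin_l _ _)).
  assert (H2e := Rlt_le_trans _ _ _ H2 (Rmin_r _ _)).
  pose proof (Cmod_ge_0 (w - z)) as Hwz. pose proof (Cmod_ge_0 (g w - g z)) as Hgw.
  set (x := Cmod (w - z)) in *. set (y := Cmod (g w - g z)) in *.
  assert (H1a : (Cmod (F w - F z - (w - z) * l) <= x)%R)
    by (pose proof (Rmin_l 1 (eps * m)); nra).
  assert (H1b : (Cmod (F w - F z - (w - z) * l) <= eps * m * x)%R)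
    by (pose proof (Rmin_r 1 (eps * m)); nra).
  assert (Hsum : (m <= Cmod (g w + g z))%R).
  { pose proof (Cmod_triangle (g w + g z) (- (g w - g z))) as T.
    replace (g w + g z + - (g w - g z)) with (2 * g z) in T by ring.
    rewrite Cmod_opp, Cmod_mult, Cmod_R, Rabs_pos_eq in T by lra.
    fold m y in T. lra. }
  assert (HyK : (y <= K * x)%R).
  { apply Rmult_le_reg_r with m; [lra|].
    apply Rle_trans with (y * Cmod (g w + g z))%R; [nra|].
    unfold y. rewrite <- Cmod_mult.
    replace ((g w - g z) * (g w + g z)) with ((F w - F z - (w - z) * l) + (w - z) * l)
      by (rewrite !HFg; ring).
    eapply Rle_trans; [apply Cmod_triangle|]. rewrite Cmod_mult. fold x.
    replace (K * x * m)%R with ((Cmod l + 1) * x)%R by (unfold K; field; lra). lra. }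
  assert (Hyy : (y * y <= eps * m * x)%R).
  { apply Rle_trans with (eps * m / K * (K * x))%R.
    - apply Rmult_le_compat; lra.
    - right. field. lra. }
  (* After multiplication by [2 * g z] the error splits into two terms, each at most
     [eps * m * x]. *)
  apply Rmult_le_reg_l with (2 * m)%R; [lra|].
  replace (2 * m)%R with (Cmod (2 * g z))
    by (rewrite Cmod_mult, Cmod_R, Rabs_pos_eq by lra; reflexivity).
  rewrite <- Cmod_mult.
  replace (2 * g z * (g w - g z - (w - z) * (l / (2 * g z)))) with
    ((F w - F z - (w - z) * l) + - ((g w - g z) * (g w - g z)))
    by (rewrite !HFg; field; exact Hgz).
  eapply Rle_trans; [apply Cmod_triangle|].
  rewrite Cmod_opp, !Cmod_mult, Cmod_R, Rabs_pos_eq by lra. fold m x y. lra.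
Qed.

Lemma entire_scal_plus (f : C -> C) (c a : C) :
  entire f -> entire (fun z => c * f z + a).
Proof.
  intros Hf z. destruct (Hf z) as [l Hl]. exists (c * l).
  apply is_C_derive_eps. intros eps Heps. pose proof (Cmod_ge_0 c) as Hc.
  destruct (proj1 (is_C_derive_eps f z l) Hl (eps / (Cmod c + 1))%R)
    as [d [Hd H]]; [apply Rdiv_lt_0_compat; lra|].
  exists d; split; [exact Hd|]. intros w Hw. specialize (H w Hw).
  replace (c * f w + a - (c * f z + a) - (w - z) * (c * l)) with
    (c * (f w - f z - (w - z) * l)) by ring.
  rewrite Cmod_mult. pose proof (Cmod_ge_0 (f w - f z - (w - z) * l)).
  apply Rle_trans with ((Cmod c + 1) * (eps / (Cmod c + 1) * Cmod (w - z)))%R.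
  - apply Rmult_le_compat; lra.
  - right. field. lra.
Qed.

Lemma entire_square : entire (fun z => z * z).
Proof.
  intros z. exists (2 * z). apply is_C_derive_eps. intros eps Heps.
  exists eps; split; [exact Heps|]. intros w Hw.
  replace (w * w - z * z - (w - z) * (2 * z)) with ((w - z) * (w - z)) by ring.
  rewrite Cmod_mult. pose proof (Cmod_ge_0 (w - z)). nra.
Qed.

Lemma entire_root (F : C -> C) :
  entire F -> (forall z, F z <> 0) ->
  exists g : C -> C, entire g /\ forall z, F z = F 0 * (g z * g z).
Proof.
  intros HF Hnz.
  destruct (continuous_root F (fun z => derivable_Ccontinuous F z (HF z)) Hnz)
    as [g Hg].
  exists g; split; [|intros z; apply Hg].
  (* It is [F / F 0] that equals the square of [g]; the shape fits [entire_scal_plus]. *)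
  intros z. apply (derivable_root (fun w => / F 0 * F w + 0)).
  - apply (entire_scal_plus F); exact HF.
  - apply Hg.
  - intros E. apply (Hnz z). rewrite (proj2 (Hg z)), E. ring.
  - intros w. rewrite (proj2 (Hg w)). field. apply Hnz.
Qed.

(** * The factorization *)

Lemma affine_surjective (g : C -> C) (w : C) : affine g -> exists z, g z = w.
Proof.
  intros [alpha [beta [Ha Hg]]]. exists ((w - beta) / alpha).
  rewrite Hg. field. exact Ha.
Qed.

(** An even function has equal values at 1 and -1, which would force [alpha] to vanish. *)
Lemma quadratic_not_affine (c a : C) : c <> 0 -> ~ affine (fun w => c * (w * w) + a).
Proof.
  intros Hc [alpha [beta [Ha H]]].
  assert (H0 := H 0). assert (H1 := H 1). assert (H2 := H (- (1))).
  assert (E : 2 * alpha = 0).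
  { transitivity ((alpha * 1 + beta) - (alpha * - (1) + beta)); [ring|].
    rewrite <- H1, <- H2. ring. }
  apply (Cmult_neq_0 2 alpha); [|exact Ha|exact E].
  intros E2. apply RtoC_inj in E2. lra.
Qed.

Theorem theorem7p3 (f : C -> C) (hf : elh f)
    (hpicard : exists a : C, forall w : C, (exists z : C, f z = w) <-> w <> a) :
  ~ prime_elh f.
Proof.
  intros [_ [_ Hprime]]. destruct hpicard as [a Ha]. apply Hprime.
  split; [exact hf|].
  set (F := fun z => 1 * f z + - a).
  assert (Hnz : forall z, F z <> 0).
  { intros z E. apply (proj1 (Ha (f z))); [now exists z|].
    transitivity (F z + a); [unfold F; ring|]. rewrite E. ring. }
  destruct (entire_root F) as [g [Hg HF]]; [apply entire_scal_plus, hf|exact Hnz|].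
  exists (fun w => F 0 * (w * w) + a), g.
  split; [apply (entire_scal_plus (fun w => w * w)), entire_square|].
  split; [exact Hg|]. split; [apply quadratic_not_affine, Hnz|]. split.
  - intros Haff. destruct (affine_surjective g 0 Haff) as [z Hz].
    apply (Hnz z). rewrite HF, Hz. ring.
  - intros z. rewrite <- HF. unfold F. ring.
Qed.
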